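(* Let $H_1,\dots,H_s$ be the components of a split decomposition of a graph $G$. Then $G$ is word-representable if and only if $H_i$ is word-representable for all $1\le i\le s$. Further, (when these graphs are word-representable) $\mathcal{R}(G)=\max_{1\le i\le s}\mathcal{R}(H_i)$.
   Context: All graphs are finite, simple and connected. A graph $G=(V,E)$ is word-representable if there is a word $w$ over $V$ such that distinct $a,b\in V$ are adjacent iff they alternate in $w$ (i.e., the subword of $w$ formed by all occurrences of $a$ and $b$ is $abab\cdots$ or $baba\cdots$). $\mathcal{R}(G)$ (the representation number) is the smallest $k$ such that $G$ is represented by a word in which each letter occurs exactly $k$ times. A split of a connected graph $G=(V,E)$ is a bipartition $\{V_1,V_2\}$ of $V$ with $|V_1|,|V_2|\ge 2$ such that every vertex of $N_G(V_1)$ is adjacent to every vertex of $N_G(V_2)$, where $N_G(A)=\bigcup_{a\in A}N_G(a)\setminus A$. Given a split, $G$ is decomposed into the two split components $G_1$ on $V_1\cup\{v_1\}$ and $G_2$ on $V_2\cup\{v_2\}$, where $v_1,v_2$ are new vertices, $G_1$ is $G[V_1]$ plus $v_1$ adjacent to every vertex of $N_G(V_2)$, and $G_2$ is $G[V_2]$ plus $v_2$ adjacent to every vertex of $N_G(V_1)$. A split decomposition of $G$ is obtained by recursively decomposing split components in this way; its components are the resulting graphs. *)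

(* Defs.v *)
From mathcomp Require Import all_boot.
From mathcomp Require Import boolp.

Set Implicit Arguments.
Unset Strict Implicit.
Unset Printing Implicit Defensive.

(* Finite simple graphs. Connectedness is kept as a separate predicate: split  *)
(* components of a connected graph are again connected.                        *)
Record graph := Graph {
  vertex :> finType;
  adj : rel vertex;
  adj_sym : symmetric adj;
  adj_irrefl : irreflexive adj }.

Arguments adj : clear implicits.

Definition connected_graph (G : graph) : Prop :=
  forall x y : G, connect (adj G) x y.

Definition subword (T : eqType) (a b : T) (w : seq T) : seq T :=
  [seq x <- w | (x == a) || (x == b)].

(* The word abab... of length n. *)
Definition alternating_word (T : Type) (a b : T) (n : nat) : seq T :=
  mkseq (fun i => if odd i then b else a) n.

Definition alternate (T : eqType) (w : seq T) (a b : T) : bool :=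
  let s := subword a b w in
  (s == alternating_word a b (size s)) || (s == alternating_word b a (size s)).

(* A word over V need not use every letter of V. This does not affect          *)
(* word-representability: if w represents G and m_1, ..., m_r are the letters  *)
(* missing from w, then m_1 ... m_r w m_1 ... m_r represents G as well.        *)
Definition represents (G : graph) (w : seq G) : Prop :=
  forall a b : G, a != b -> adj G a b = alternate w a b.

Definition word_representable (G : graph) : Prop :=
  exists w : seq G, represents w.

Definition uniform (T : eqType) (k : nat) (w : seq T) : Prop :=
  forall x : T, count_mem x w = k.

(* The case k = 0 is excluded: the empty word represents every complete graph, *)
(* whose representation number is by convention 1.                             *)
Definition k_representable (G : graph) (k : nat) : Prop :=
  0 < k /\ exists2 w : seq G, uniform k w & represents w.

(* The default value 0 is never taken on a word-representable graph, since     *)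
(* such a graph is k-representable for some k (Kitaev and Pyatkin).            *)
Definition representation_number (G : graph) : nat :=
  match pselect (exists k, `[< k_representable G k >]) with
  | left ex_k => ex_minn ex_k
  | right _ => 0
  end.

Definition neighbourhood (G : graph) (A : {set G}) : {set G} :=
  (\bigcup_(a in A) [set x | adj G a x]) :\: A.

Definition is_split (G : graph) (V1 V2 : {set G}) : Prop :=
  [/\ V2 = ~: V1, 2 <= #|V1|, 2 <= #|V2| &
      forall x y : G, x \in neighbourhood V1 -> y \in neighbourhood V2 ->
        adj G x y].

Section SplitComponent.
Variables (G : graph) (A B : {set G}).

(* None is the new vertex. *)
Definition component_adj : rel (option {x : G | x \in A}) :=
  fun u v => match u, v with
    | Some x, Some y => adj G (val x) (val y)
    | Some x, None | None, Some x => val x \in neighbourhood B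
    | None, None => false
    end.

Lemma component_adj_sym : symmetric component_adj.
Proof. by move=> [x|] [y|] //=; rewrite adj_sym. Qed.

Lemma component_adj_irrefl : irreflexive component_adj.
Proof. by move=> [x|] //=; rewrite adj_irrefl. Qed.

(* For a split {A, B}, this is the component containing A. *)
Definition split_component : graph :=
  Graph component_adj_sym component_adj_irrefl.

End SplitComponent.

(* split_decomposition G Hs: Hs lists, with repetitions, the components of     *)
(* some split decomposition of G; stopping at any stage is allowed.            *)
Inductive split_decomposition : graph -> seq graph -> Prop :=
  | SplitLeaf (G : graph) : split_decomposition G [:: G]
  | SplitNode (G : graph) (V1 V2 : {set G}) (Hs1 Hs2 : seq graph) :
      is_split V1 V2 ->
      split_decomposition (split_component V1 V2) Hs1 ->
      split_decomposition (split_component V2 V1) Hs2 ->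
      split_decomposition G (Hs1 ++ Hs2).

(* Main.v *)
(* For uniform words alternation is invariant under rotation. Hence, if {A, B} *)
(* is a split of G whose components are k-represented by w1 and w2, we may     *)
(* assume w1 = v1 u_1 ... v1 u_k and w2 = v2 t_1 ... v2 t_k, where v1 and v2   *)
(* are the new vertices; then u_1 t_1 ... u_k t_k represents G: a letter       *)
(* adjacent to v1 occurs exactly once in every u_i, while any other letter of  *)
(* A occurs twice in some u_i and so alternates with no letter of B.           *)
(* Conversely, if G is connected the components are induced subgraphs of G.    *)
(* So G is k-representable iff all components of a split decomposition are;    *)
(* the theorem follows, since every word can be made k-uniform for any k       *)
(* bounding its multiplicities.                                                *)
Require Import Defs.
From mathcomp Require Import all_boot.
From mathcomp Require Import boolp zify.

Set Implicit Arguments.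
Unset Strict Implicit.
Unset Printing Implicit Defensive.

(** The heart is an equivalence for each fixed multiplicity [k]: a connected [G] is
    [k]-representable iff all components are ([k_representable_decomposition]). Downwards, a split
    component is an induced subgraph of [G], some vertex across the split playing the new vertex,
    and deleting letters restricts a representation ([k_representable_component]). Upwards,
    [k]-uniform words for the two components are rotated to start with the new vertex, cut at its
    [k] occurrences, and their pieces interleaved. Letters from opposite sides then alternate iff
    each occurs once in every piece of its own word, that is, iff both are adjacent to the new
    vertices ([k_representable_glue]). Since words can be made uniform without changing alternation
    ([uniformize]), [k]-representability is upward closed in [k], and the equivalence for every [k]
    yields both claims. *)

Definition neq_op (T : eqType) : rel T := fun x y => x != y.
Arguments neq_op {T}.

(** * Alternation as absence of immediate repetitions *)

Section Alternation.
Variable T : eqType.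
Implicit Types (a b x y : T) (s t w : seq T).

Lemma uniq_sorted_neq s : uniq s -> sorted neq_op s.
Proof. by rewrite uniq_pairwise => /pairwise_sorted. Qed.

Lemma all_subword a b w : all (fun x => (x == a) || (x == b)) (subword a b w).
Proof. exact: filter_all. Qed.

Lemma subword_cat a b w1 w2 :
  subword a b (w1 ++ w2) = subword a b w1 ++ subword a b w2.
Proof. exact: filter_cat. Qed.

Lemma subword_flatten a b (ss : seq (seq T)) :
  subword a b (flatten ss) = flatten [seq subword a b s | s <- ss].
Proof. exact: filter_flatten. Qed.

Lemma subword_filter (P : pred T) a b w :
  P a -> P b -> subword a b (filter P w) = subword a b w.
Proof.
move=> Pa Pb; rewrite /subword -filter_predI; apply: eq_filter => x /=.
by case: eqP => [->|_]; [rewrite Pa | case: eqP => [->|//]; rewrite Pb].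
Qed.

Lemma subwordC a b w : subword a b w = subword b a w.
Proof. by apply: eq_filter => x; rewrite orbC. Qed.

Lemma count_subword a b w : count_mem a (subword a b w) = count_mem a w.
Proof.
rewrite count_filter; apply: eq_count => x /=.
by case: eqP.
Qed.

Lemma count_subwordr a b w : count_mem b (subword a b w) = count_mem b w.
Proof. by rewrite subwordC count_subword. Qed.

Lemma alternating_wordS a b n :
  alternating_word a b n.+1 = a :: alternating_word b a n.
Proof.
rewrite /alternating_word /mkseq /= -[1]/(1 + 0) iotaDl -map_comp /=.
by congr (_ :: _); apply: eq_map => i /=; case: (odd i).
Qed.

Lemma alternating_wordP a b s : a != b ->
    all (fun x => (x == a) || (x == b)) s ->
  (s == alternating_word a b (size s)) = path neq_op b s.
Proof.
elim: s a b => [|x s IHs] a b neq_ab //= /andP[x_ab s_ab].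
rewrite alternating_wordS eqseq_cons /neq_op.
case/orP: x_ab => /eqP->; last by rewrite eqxx eq_sym (negPf neq_ab).
rewrite eqxx (eq_sym b) neq_ab /= IHs 1?eq_sym //.
by apply: sub_all s_ab => y; rewrite orbC.
Qed.

(** Only two letters remain in the restriction, so alternating means that neither is immediately
    repeated; this form is easy to handle under concatenation. *)
Lemma alternateE w a b : a != b ->
  alternate w a b = sorted neq_op (subword a b w).
Proof.
move=> neq_ab; have s_ab := all_subword a b w; rewrite /alternate.
move: (subword a b w) s_ab => s s_ab.
have s_ba : all (fun x => (x == b) || (x == a)) s.
  by apply: sub_all s_ab => y; rewrite orbC.
rewrite !alternating_wordP 1?eq_sym // 1?eq_sym //.
case: s s_ab {s_ba} => [|x s] //= /andP[x_ab _]; rewrite /neq_op.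
by case/orP: x_ab => /eqP->; rewrite eqxx ?neq_ab // eq_sym neq_ab orbF.
Qed.

(** Every [b] is followed by its own [a], because the word ends in [a]; a leading [a] comes on top
    of these. *)
Lemma count_alternating a b x s : a != b ->
    all (fun x => (x == a) || (x == b)) (x :: s) -> path neq_op x s ->
    last x s = a ->
  count_mem b (x :: s) + (x == a) <= count_mem a (x :: s).
Proof.
move=> neq_ab; elim: s x => [|y s IHs] x.
  by move=> _ _ /= ->; rewrite (negPf neq_ab) eqxx.
move=> /andP[x_ab ys_ab] /= /andP[neq_xy y_s] last_s.
have /= := IHs y ys_ab y_s last_s; move: ys_ab neq_xy => /= /andP[y_ab _].
have neq_ba : b != a by rewrite eq_sym.
rewrite /neq_op; case/orP: x_ab => /eqP->; case/orP: y_ab => /eqP->;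
  rewrite ?eqxx ?(negPf neq_ab) ?(negPf neq_ba) //= => _; lia.
Qed.

(** If the first and last letters agreed, that letter would occur more often than the other. The
    cyclic form makes alternation invariant under rotation. *)
Lemma sorted_cycle a b s : a != b ->
    all (fun x => (x == a) || (x == b)) s -> count_mem a s = count_mem b s ->
  sorted neq_op s = cycle neq_op s.
Proof.
case: s => [//|x s] neq_ab s_ab eq_count; rewrite /cycle rcons_path /=.
case path_s: (path _ _ _) => //=; rewrite /neq_op; apply/esym/eqP => last_s.
have neq_ba : b != a by rewrite eq_sym.
have /= /andP[/orP[] /eqP def_x _] := s_ab.
- have := count_alternating neq_ab s_ab path_s; rewrite last_s def_x eqxx.
  by move: eq_count; rewrite def_x => -> /(_ erefl); rewrite addn1 ltnn.
- have s_ba : all (fun x => (x == b) || (x == a)) (x :: s).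
    by apply: sub_all s_ab => y; rewrite orbC.
  have := count_alternating neq_ba s_ba path_s; rewrite last_s def_x eqxx.
  by move: eq_count; rewrite def_x => -> /(_ erefl); rewrite addn1 ltnn.
Qed.

Lemma alternate_rot a b w n : a != b -> count_mem a w = count_mem b w ->
  alternate (rot n w) a b = alternate w a b.
Proof.
move=> neq_ab eq_count; rewrite !alternateE //.
rewrite !(sorted_cycle neq_ab) ?all_subword ?count_subword ?count_subwordr //.
- rewrite /rot subword_cat -{3}(cat_take_drop n w) subword_cat.
  exact: cycle_catC.
- by rewrite !(seq.permP (permEl (perm_rot n w))).
Qed.

(** [undup] keeps last occurrences, so for nonempty [s] the appended word ends in the last letter of
    [s]. Being repetition-free with at least two letters, it starts with a different one, and no
    repetition arises at the junction. *)
Lemma sorted_cat_undup e s x : {subset s <= e} -> x \in e ->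
    (exists2 y, y \in e & y != x) ->
  sorted neq_op (s ++ undup (e ++ s)) = sorted neq_op s.
Proof.
move=> sub_se x_e [y y_e neq_yx].
case/lastP: s sub_se => [|s c] sub_se; first by rewrite uniq_sorted_neq ?undup_uniq.
have c_e : c \in e by apply: sub_se; rewrite mem_rcons mem_head.
have [z z_e neq_zc] : exists2 z, z \in e & z != c.
  have [eq_cx | neq_cx] := eqVneq c x; first by exists y; rewrite ?eq_cx.
  by exists x; rewrite // eq_sym.
have uniqU := undup_uniq (e ++ rcons s c).
rewrite -rcons_cat undup_rcons in uniqU *.
have: z \in [seq y <- undup (e ++ s) | y != c].
  by rewrite mem_filter mem_undup mem_cat z_e neq_zc.
case: filter uniqU => [//|u U] uniqU _.
rewrite -cats1 -catA /=; move: uniqU => /= /andP[u_U uniqU].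
have sorted_U: path neq_op u (rcons U c).
  by apply: (@uniq_sorted_neq (u :: rcons U c)); rewrite /= u_U.
have neq_cu : neq_op c u by apply: contraNneq u_U => ->; rewrite mem_rcons mem_head.
by case: s {sub_se} => [|d s] /=; rewrite ?cat_path /= neq_cu sorted_U ?andbT.
Qed.

Lemma sorted_neq_nseq n a : sorted neq_op (nseq n a) = (n <= 1).
Proof. by case: n => [|[|n]] //=; rewrite /neq_op eqxx. Qed.

Lemma all_eq1 (ns : seq nat) : sumn ns = size ns -> all (leq^~ 1) ns ->
  all (pred1 1) ns.
Proof.
have bound (ms : seq nat) : all (leq^~ 1) ms -> sumn ms <= size ms.
  by elim: ms => //= m ms IHms /andP[m1 /IHms]; lia.
elim: ns => //= n ns IHns sum_ns /andP[n1 ns1]; have := bound _ ns1.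
by move=> ?; rewrite IHns // ?andbT; [apply/eqP | ]; lia.
Qed.

(** Absence of repetitions bounds every exponent by 1, and the prescribed sums then force
    equality. *)
Lemma sorted_blocks a b (cds : seq (nat * nat)) : a != b ->
    sumn (unzip1 cds) = size cds -> sumn (unzip2 cds) = size cds ->
  sorted neq_op (flatten [seq nseq cd.1 a ++ nseq cd.2 b | cd <- cds])
    = all (pred1 1) (unzip1 cds) && all (pred1 1) (unzip2 cds).
Proof.
move=> neq_ab sum1 sum2; apply/idP/andP => [sorted_s | [ones1 ones2]].
- suff [le1 le2]: all (leq^~ 1) (unzip1 cds) /\ all (leq^~ 1) (unzip2 cds).
    by split; apply: all_eq1; rewrite // size_map.
  elim: cds sorted_s {sum1 sum2} => [|[c d] cds IHcds] //=.
  move=> /cat_sorted2[/cat_sorted2[]].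
  by rewrite !sorted_neq_nseq => -> -> /IHcds[-> ->].
- apply: (@path_sorted _ _ b); elim: cds ones1 ones2 {sum1 sum2} => //=.
  move=> [c d] cds IHcds /= /andP[/eqP-> ones1] /andP[/eqP-> ones2] /=.
  by rewrite /neq_op neq_ab eq_sym neq_ab; apply: IHcds.
Qed.

End Alternation.

Lemma subword_map (T T' : eqType) (f : T -> T') a b w : injective f ->
  subword (f a) (f b) (map f w) = map f (subword a b w).
Proof.
move=> f_inj; rewrite /subword filter_map; congr map.
by apply: eq_filter => x /=; rewrite !(inj_eq f_inj).
Qed.

Lemma alternate_map (T T' : eqType) (f : T -> T') a b w :
  injective f -> a != b -> alternate (map f w) (f a) (f b) = alternate w a b.
Proof.
move=> f_inj neq_ab; rewrite !alternateE ?inj_eq // subword_map // sorted_map.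
by apply: eq_sorted => x y; rewrite /neq_op /= inj_eq.
Qed.

Lemma alternate_filter (T : eqType) (P : pred T) a b w :
  P a -> P b -> alternate (filter P w) a b = alternate w a b.
Proof. by move=> Pa Pb; rewrite /alternate subword_filter. Qed.

Lemma count_map_inj (T T' : eqType) (f : T -> T') x w :
  injective f -> count_mem (f x) (map f w) = count_mem x w.
Proof.
by move=> f_inj; rewrite count_map; apply: eq_count => y /=; rewrite inj_eq.
Qed.

(** * Uniform words and the representation number as a threshold *)

Section Uniformization.
Variable G : graph.
Implicit Types w : seq G.

(* The letters occurring less than k times are appended once more, in the      *)
(* order of their last occurrences (which is the order kept by undup), the     *)
(* letters missing from w coming first.                                        *)
Lemma raise_multiplicities w k : represents w ->
  exists2 w' : seq G, represents w' &
    forall x, count_mem x w' = count_mem x w + (count_mem x w < k).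
Proof.
move=> rep_w; pose A := fun x => count_mem x w < k.
pose U := undup (enum G ++ w).
have count_U x : count_mem x (filter A U) = A x.
  rewrite count_uniq_mem ?filter_uniq ?undup_uniq // mem_filter mem_undup.
  by rewrite mem_cat mem_enum andbT.
(* Only [a] is appended, and it is rarer than [b] in [w], so an alternating restriction cannot
   already end in [a]. *)
have extend a b : a != b -> A a -> ~~ A b ->
    sorted neq_op (subword a b w ++ subword a b (filter A U))
      = sorted neq_op (subword a b w).
  move=> neq_ab Aa Ab.
  have -> : subword a b (filter A U) = [:: a].
    apply: perm_small_eq => //; apply/allP => x _ /=; apply/eqP.
    have [-> | neq_xa] := eqVneq x a; first by rewrite count_subword count_U Aa.
    apply/count_memPn.
    rewrite !mem_filter (negPf neq_xa) /=.
    by case: eqP => //= ->; rewrite (negPf Ab).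
  have := all_subword a b w.
  have: count_mem a (subword a b w) < count_mem b (subword a b w).
    by rewrite count_subword count_subwordr (leq_trans Aa) // leqNgt.
  case: (subword a b w) => [//|x s] lt_ab s_ab /=; rewrite cat_path /= andbT.
  case path_s: path => //=; apply/negP => /eqP last_s.
  by have := count_alternating neq_ab s_ab path_s last_s; rewrite leqNgt ltn_addr.
exists (w ++ filter A U) => [a b neq_ab | x]; last by rewrite count_cat count_U.
rewrite rep_w // !alternateE // subword_cat.
case Aa: (A a); case Ab: (A b).
- have -> : subword a b (filter A U) = undup (subword a b (enum G) ++ subword a b w).
    by rewrite subword_filter // /subword filter_undup filter_cat.
  rewrite (@sorted_cat_undup _ _ _ a) //.
  + by move=> x; rewrite mem_filter => /andP[x_ab _]; rewrite mem_filter x_ab mem_enum.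
  + by rewrite mem_filter mem_enum eqxx.
  + by exists b; rewrite 1?eq_sym // mem_filter mem_enum eqxx orbT.
- by rewrite extend ?Ab.
- by rewrite !(subwordC a b) extend ?Aa // eq_sym.
- have -> : subword a b (filter A U) = [::]; last by rewrite cats0.
  rewrite /subword -filter_predI -(filter_pred0 U); apply: eq_filter => x /=.
  by case: eqP => [->|_]; [rewrite Aa | case: eqP => // ->; rewrite Ab].
Qed.

Lemma uniformize w k : represents w -> (forall x, count_mem x w <= k) ->
  exists2 w' : seq G, uniform k w' & represents w'.
Proof.
move=> rep_w le_wk.
(* Each round adds one occurrence up to the cap [k]; [k] rounds suffice even for a missing
   letter. *)
have raise n : exists2 w' : seq G, represents w' &
    forall x, count_mem x w' = minn k (count_mem x w + n).
  elim: n => [|n [w' rep_w' count_w']].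
    by exists w => // x; rewrite addn0 (minn_idPr (le_wk x)).
  have [w'' rep_w'' count_w''] := raise_multiplicities k rep_w'.
  by exists w'' => // x; rewrite count_w'' count_w'; lia.
have [w' rep_w' count_w'] := raise k.
by exists w' => // x; rewrite count_w'; lia.
Qed.

Lemma word_representableP :
  word_representable G <-> exists k, k_representable G k.
Proof.
split=> [[w rep_w] | [k [_ [w _ rep_w]]]]; last by exists w.
(* The successor keeps the multiplicity positive when [w] is empty. *)
exists (size w).+1; split=> //; apply: uniformize rep_w _ => x.
exact/leqW/count_size.
Qed.

Lemma k_representable_leq k l :
  k <= l -> k_representable G k -> k_representable G l.
Proof.
move=> le_kl [k_gt0 [w unif_w rep_w]]; split; first exact: leq_trans le_kl.
by apply: uniformize rep_w _ => x; rewrite unif_w.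
Qed.

(** Word-representability rules out the default value 0, which would lie below every [k]. *)
Lemma representation_number_leq k : word_representable G ->
  representation_number G <= k <-> k_representable G k.
Proof.
move=> /word_representableP[l repl]; rewrite /representation_number.
case: pselect => [ex_k | []]; last by exists l; apply/asboolP.
case: ex_minnP => m /asboolP repm min_m; split=> [le_mk | repk].
  exact: k_representable_leq repm.
exact/min_m/asboolP.
Qed.

Lemma k_representable_rot k (v : G) : k_representable G k ->
  exists w : seq G, [/\ uniform k (v :: w) & represents (v :: w)].
Proof.
move=> [k_gt0 [w unif_w rep_w]].
have /rot_to[i w' def_w'] : v \in w by rewrite -has_pred1 has_count unif_w.
exists w'; rewrite -def_w'; split=> [x | a b neq_ab].
  by rewrite (seq.permP (permEl (perm_rot i w))).
by rewrite alternate_rot ?unif_w // rep_w.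
Qed.

End Uniformization.

(** Mapping the partial inverse [g] of [f] over the word deletes the letters outside the image and
    renames the others. *)
Lemma k_representable_induced (G H : graph) (f : H -> G) k :
    injective f -> (forall x y, adj H x y = adj G (f x) (f y)) ->
  k_representable G k -> k_representable H k.
Proof.
move=> f_inj adjE [k_gt0 [w unif_w rep_w]]; split=> //.
pose g y := [pick x | f x == y].
have gK : ocancel g f by rewrite /g => y; case: pickP => //= x /eqP.
have isSome_g x : g (f x) by rewrite /g; case: pickP => // /(_ x); rewrite eqxx.
have map_w' := pmap_filter gK w.
exists (pmap g w) => [x | a b neq_ab].
- rewrite -(count_map_inj _ _ f_inj) map_w' count_filter -(unif_w (f x)).
  by apply: eq_count => y /=; case: eqP => // ->; rewrite isSome_g.
- rewrite adjE rep_w ?inj_eq // -(alternate_map _ f_inj neq_ab) map_w'.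
  by rewrite alternate_filter.
Qed.

(** * Split components as induced subgraphs *)

Section Split.
Variable G : graph.
Implicit Types A B : {set G}.

Lemma neighbourhoodP A x :
  reflect (x \notin A /\ exists2 a, a \in A & adj G a x) (x \in neighbourhood A).
Proof.
rewrite inE; apply: (iffP andP) => [[xA /bigcupP[a aA]] | [xA [a aA ax]]].
  by rewrite inE => ax; split=> //; exists a.
by split=> //; apply/bigcupP; exists a; rewrite ?inE.
Qed.

Lemma is_splitC A B : is_split A B -> is_split B A.
Proof.
case=> -> sA sB AB; split; rewrite ?setCK // => x y xA yB.
by rewrite adj_sym AB.
Qed.

(** [neighbourhood B] is the part of [A] with neighbours in [B], and symmetrically; the split
    condition joins these two parts completely. *)
Lemma adj_across A B x y : is_split A B -> x \in A -> y \in B ->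
  adj G x y = (x \in neighbourhood B) && (y \in neighbourhood A).
Proof.
case=> defB _ _ AB xA yB; apply/idP/andP => [xy | [xB yA]]; last first.
  by rewrite adj_sym AB.
have [xB yA] : x \notin B /\ y \notin A by move: yB; rewrite defB !inE xA.
split; apply/neighbourhoodP; split=> //; last by exists x.
by exists y; rewrite // adj_sym.
Qed.

Lemma split_component_connected A B : is_split A B -> connected_graph G ->
  connected_graph (split_component A B).
Proof.
move=> splitAB conG.
have [defB _ /ltnW/card_gt0P[z zB] _] := splitAB.
(* [p] collapses [B] to the new vertex; each edge of [G] is mapped to an edge or contracted. *)
pose p x : split_component A B := insub x.
have connect_p x y : connect (adj G) x y -> connect (adj (split_component A B)) (p x) (p y).
  case/connectP=> s xs ->; elim: s x xs => //= x' s IHs x /andP[xx' /IHs].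
  apply: connect_trans; rewrite /p.
  case: (insubP {x | x \in A} x) => [u xA def_u|xA];
    case: (insubP {x | x \in A} x') => [u' x'A def_u'|x'A] //=.
  - by apply: connect1; rewrite /= def_u def_u'.
  - have x'B : x' \in B by rewrite defB inE.
    apply: connect1 => /=; rewrite def_u.
    by move: xx'; rewrite (adj_across splitAB) // => /andP[].
  - have xB : x \in B by rewrite defB inE.
    apply: connect1 => /=; rewrite def_u'.
    by move: xx'; rewrite adj_sym (adj_across splitAB) // => /andP[].
have surj_p (u : split_component A B) : exists x, u = p x.
  case: u => [u|]; first by exists (val u); rewrite /p valK.
  by exists z; rewrite /p insubN //; move: zB; rewrite defB inE.
move=> u v; have [x ->] := surj_p u; have [y ->] := surj_p v.
exact/connect_p/conG.
Qed.

Lemma k_representable_component A B k : is_split A B -> connected_graph G ->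
  k_representable G k -> k_representable (split_component A B) k.
Proof.
move=> splitAB conG.
have [defB /ltnW/card_gt0P[z zA] _ _] := splitAB.
(* By connectedness a path leads from the new vertex to [z]; its first step reaches a vertex of [A]
   with a neighbour in [B]. *)
have [y yB yA] : exists2 y, y \in B & y \in neighbourhood A.
  have /connectP[[//|u s] /= /andP[]] :=
    split_component_connected splitAB conG None (Some (exist _ z zA)).
  case: u => // x /neighbourhoodP[xB [y yB yx]] _ _; exists y => //.
  apply/neighbourhoodP; split; first by move: yB; rewrite defB inE.
  by exists (val x); [exact: valP | rewrite adj_sym].
have neq_xy (x : {x | x \in A}) : val x != y.
  by apply: contraTneq (valP x) => ->; move: yB; rewrite defB inE.
(* Inside [A], the neighbours of [y] are exactly those of the new vertex. *)
pose f (u : split_component A B) := if u is Some x then val x else y.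
apply: (@k_representable_induced _ _ f).
- case=> [x|] [x'|] //= => [/val_inj -> // | /eqP | /eqP].
    by rewrite (negPf (neq_xy x)).
  by rewrite eq_sym (negPf (neq_xy x')).
- case=> [x|] [x'|] //=; rewrite ?adj_irrefl //.
    by rewrite (adj_across splitAB) ?yA ?andbT //; apply: valP.
  by rewrite adj_sym (adj_across splitAB) ?yA ?andbT //; apply: valP.
Qed.

End Split.

(** * Cutting a word at the occurrences of the new vertex *)

Section Interleaving.
Variables (T : eqType).
Implicit Types (us : seq (seq T)) (w : seq (option T)).

Definition blocks us : seq (option T) :=
  flatten [seq None :: map Some u | u <- us].

Lemma blocksP w : exists us, None :: w = blocks us.
Proof.
(* [u0] is the stretch before the first [None] of [w], which the induction has to carry along. *)
suff [u0 [us ->]] : exists u0, exists us, w = map Some u0 ++ blocks us.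
  by exists (u0 :: us).
elim: w => [|[x|] w [u0 [us ->]]]; first by exists [::], [::].
  by exists (x :: u0), us.
by exists [::], (u0 :: us).
Qed.

Lemma count_None_blocks us : count_mem None (blocks us) = size us.
Proof.
elim: us => //= u us IHus; rewrite count_cat IHus count_map.
by rewrite (@eq_count _ _ pred0) ?count_pred0.
Qed.

Lemma filter_blocks us : filter isSome (blocks us) = map Some (flatten us).
Proof.
elim: us => //= u us IHus; rewrite filter_cat IHus map_cat; congr (_ ++ _).
by rewrite filter_map (@eq_filter _ _ predT) ?filter_predT.
Qed.

Lemma count_Some_blocks us x :
  count_mem (Some x) (blocks us) = count_mem x (flatten us).
Proof.
rewrite -(count_map_inj x (flatten us) Some_inj) -filter_blocks count_filter.
by apply: eq_count => -[y|] //=; rewrite andbT.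
Qed.

Lemma subword_notin (S : eqType) (a b : S) (w : seq S) :
  b \notin w -> subword a b w = nseq (count_mem a w) a.
Proof.
elim: w => //= c w IHw; rewrite inE negb_or => /andP[/negPf neq_bc /IHw ->].
by rewrite orbC eq_sym neq_bc /=; case: eqP => [->|].
Qed.

(** This is [sorted_blocks] with all exponents of [None] equal to 1. *)
Lemma alternate_blocks us x : count_mem x (flatten us) = size us ->
  alternate (blocks us) None (Some x) = all (pred1 1) [seq count_mem x u | u <- us].
Proof.
move=> count_x; rewrite alternateE //.
pose cds := [seq (1, count_mem x u) | u <- us].
have -> : subword None (Some x) (blocks us)
    = flatten [seq nseq cd.1 None ++ nseq cd.2 (Some x) | cd <- cds].
  rewrite subword_flatten -!map_comp; congr flatten; apply: eq_map => u /=.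
  rewrite subwordC subword_notin; last by apply/mapP => -[].
  by rewrite count_map_inj //; apply: Some_inj.
have unzip1_cds : unzip1 cds = nseq (size us) 1.
  by rewrite /unzip1 -map_comp; elim: us {count_x cds} => //= u us ->.
have unzip2_cds : unzip2 cds = [seq count_mem x u | u <- us].
  by rewrite /unzip2 -map_comp.
rewrite (@sorted_blocks _ _ _ cds) // ?unzip1_cds ?unzip2_cds.
- by rewrite all_nseq orbT.
- by rewrite sumn_nseq mul1n size_map.
- by rewrite size_map -count_x count_flatten.
Qed.

End Interleaving.

(** * Gluing representations of the two components *)

Section Gluing.
Variables (G : graph) (A B : {set G}).
Hypothesis splitAB : is_split A B.
Notation TA := {x : G | x \in A}.
Notation TB := {x : G | x \in B}.

Lemma notin_splitr (x : TA) : val x \notin B.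
Proof. by have [-> _ _ _] := splitAB; rewrite inE negbK; apply: valP. Qed.

Lemma notin_splitl (y : TB) : val y \notin A.
Proof.
have [defB _ _ _] := splitAB.
by case: y => y /= yB; move: yB; rewrite defB inE.
Qed.

Definition glue (uts : seq (seq TA * seq TB)) : seq G :=
  flatten [seq map val ut.1 ++ map val ut.2 | ut <- uts].

Lemma filter_glue1 uts :
  filter [in A] (glue uts) = map val (flatten (unzip1 uts)).
Proof.
elim: uts => //= [[u t] uts IHuts]; rewrite !filter_cat IHuts map_cat /=.
congr (_ ++ _); rewrite !filter_map.
rewrite (@eq_filter _ _ predT) => [|x]; last exact: (valP x).
rewrite (@eq_filter _ _ pred0 _ t) => [|y]; last exact/negbTE/notin_splitl.
by rewrite filter_predT filter_pred0 cats0.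
Qed.

Lemma filter_glue2 uts :
  filter [in B] (glue uts) = map val (flatten (unzip2 uts)).
Proof.
elim: uts => //= [[u t] uts IHuts]; rewrite !filter_cat IHuts map_cat /=.
congr (_ ++ _); rewrite !filter_map.
rewrite (@eq_filter _ _ predT _ t) => [|y]; last exact: (valP y).
rewrite (@eq_filter _ _ pred0) => [|x]; last exact/negbTE/notin_splitr.
by rewrite filter_predT filter_pred0.
Qed.

Lemma alternate_glue uts (x : TA) (y : TB) :
    count_mem x (flatten (unzip1 uts)) = size uts ->
    count_mem y (flatten (unzip2 uts)) = size uts ->
  alternate (glue uts) (val x) (val y)
    = all (pred1 1) [seq count_mem x u | u <- unzip1 uts]
      && all (pred1 1) [seq count_mem y t | t <- unzip2 uts].
Proof.
move=> count_x count_y.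
have neq_xy : val x != val y.
  by apply: contraTneq (valP x) => ->; apply: notin_splitl.
pose cds := [seq (count_mem x ut.1, count_mem y ut.2) | ut <- uts].
have unzip1_cds : unzip1 cds = [seq count_mem x u | u <- unzip1 uts].
  by rewrite /unzip1 -!map_comp.
have unzip2_cds : unzip2 cds = [seq count_mem y t | t <- unzip2 uts].
  by rewrite /unzip2 -!map_comp.
rewrite alternateE //.
have -> : subword (val x) (val y) (glue uts)
    = flatten [seq nseq cd.1 (val x) ++ nseq cd.2 (val y) | cd <- cds].
  rewrite subword_flatten -!map_comp; congr flatten; apply: eq_map => -[u t] /=.
  rewrite subword_cat subword_notin; last first.
    by apply/mapP => -[z _ eq_yz]; case/negP: (notin_splitl y); 
      rewrite /= eq_yz; apply: (valP z).
  rewrite subwordC subword_notin; last first.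
    by apply/mapP => -[z _ eq_xz]; case/negP: (notin_splitr x); 
      rewrite /= eq_xz; apply: (valP z).
  by rewrite !(count_map_inj _ _ val_inj).
rewrite (@sorted_blocks _ _ _ cds) // ?unzip1_cds ?unzip2_cds //.
- by rewrite size_map -count_x count_flatten.
- by rewrite size_map -count_y count_flatten.
Qed.

Lemma k_representable_glue k :
    k_representable (split_component A B) k ->
    k_representable (split_component B A) k ->
  k_representable G k.
Proof.
move=> repA repB; have [k_gt0 _] := repA; split=> //.
have [wA [unifA repwA]] := k_representable_rot (None : split_component A B) repA.
have [wB [unifB repwB]] := k_representable_rot (None : split_component B A) repB.
have [us def_us] := blocksP wA; have [ts def_ts] := blocksP wB.
rewrite {}def_us {wA repA} in unifA repwA; rewrite {}def_ts {wB repB} in unifB repwB.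
have size_us : size us = k by rewrite -(unifA None) count_None_blocks.
have size_ts : size ts = k by rewrite -(unifB None) count_None_blocks.
pose uts := zip us ts.
have uts1 : unzip1 uts = us by rewrite unzip1_zip // size_us size_ts.
have uts2 : unzip2 uts = ts by rewrite unzip2_zip // size_us size_ts.
have size_uts : size uts = k by rewrite size_zip size_us size_ts minnn.
have count_us x : count_mem x (flatten us) = k by rewrite -count_Some_blocks unifA.
have count_ts y : count_mem y (flatten ts) = k by rewrite -count_Some_blocks unifB.
have cover (x : G) : (exists a : TA, x = val a) \/ (exists b : TB, x = val b).
  have [xA | xA] := boolP (x \in A); first by left; exists (exist _ x xA).
  have xB : x \in B by have [-> _ _ _] := splitAB; rewrite inE.
  by right; exists (exist _ x xB).
(* Occurring once in every piece means alternating with [None] in the component's word, hence being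
   adjacent to the new vertex. *)
have across (a : TA) (b : TB) :
    adj G (val a) (val b) = alternate (glue uts) (val a) (val b).
  rewrite (adj_across splitAB) ?alternate_glue ?uts1 ?uts2 ?size_uts //;
    try exact: valP.
  rewrite -!alternate_blocks ?count_us ?count_ts ?size_us ?size_ts //.
  by congr andb; [rewrite -repwA | rewrite -repwB].
exists (glue uts).
- move=> x; case: (cover x) => -[a ->{x}].
  + rewrite -(count_us a) -uts1 -(count_map_inj _ _ val_inj) -filter_glue1.
    rewrite count_filter; apply: eq_count => y /=.
    by case: eqP => // ->; rewrite (valP a).
  + rewrite -(count_ts a) -uts2 -(count_map_inj _ _ val_inj) -filter_glue2.
    rewrite count_filter; apply: eq_count => y /=.
    by case: eqP => // ->; rewrite (valP a).
(* For two letters on one side, the glued word and that side's component word restrict to the same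
   sequence of letters. *)
- move=> x y; case: (cover x) => -[a ->{x}]; case: (cover y) => -[b ->{y}] neq_ab //.
  + have neq_ab' : a != b by rewrite -(inj_eq val_inj).
    have := repwA (Some a) (Some b) neq_ab'; rewrite /= => ->.
    rewrite -(alternate_filter (P := [in A]) _ (valP a) (valP b)) filter_glue1.
    rewrite (alternate_map _ val_inj neq_ab') uts1.
    by rewrite -(alternate_map _ Some_inj neq_ab') -filter_blocks alternate_filter.
  + rewrite adj_sym across; rewrite !alternateE // 1?eq_sym //.
    by rewrite subwordC.
  + have neq_ab' : a != b by rewrite -(inj_eq val_inj).
    have := repwB (Some a) (Some b) neq_ab'; rewrite /= => ->.
    rewrite -(alternate_filter (P := [in B]) _ (valP a) (valP b)) filter_glue2.
    rewrite (alternate_map _ val_inj neq_ab') uts2.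
    by rewrite -(alternate_map _ Some_inj neq_ab') -filter_blocks alternate_filter.
Qed.

End Gluing.

(** * Whole decompositions and the representation number *)

Lemma k_representable_decomposition (G : graph) (Hs : seq graph) k :
    split_decomposition G Hs -> connected_graph G ->
  k_representable G k <-> all (fun H => `[< k_representable H k >]) Hs.
Proof.
elim=> {G Hs} [G _ | G A B Hs1 Hs2 splitAB _ IH1 _ IH2 conG].
  by rewrite /= andbT; split=> /asboolP.
have splitBA := is_splitC splitAB.
have {}IH1 := IH1 (split_component_connected splitAB conG).
have {}IH2 := IH2 (split_component_connected splitBA conG).
rewrite all_cat; split=> [repG | /andP[/IH1 rep1 /IH2 rep2]].
  by apply/andP; split; [apply/IH1 | apply/IH2]; apply: k_representable_component.
exact: k_representable_glue rep2.
Qed.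

Theorem theorem2 (G : graph) (G_connected : connected_graph G)
    (s : nat) (H : 'I_s -> graph)
    (decH : split_decomposition G [seq H i | i <- enum 'I_s]) :
  (word_representable G <-> forall i : 'I_s, word_representable (H i)) /\
  (word_representable G ->
     representation_number G = \max_(i < s) representation_number (H i)).
Proof.
have repE k : k_representable G k <-> forall i, k_representable (H i) k.
  apply: iff_trans (k_representable_decomposition k decH G_connected) _.
  rewrite all_map; split=> [/allP rep i | rep].
    by have /(_ i) := rep; rewrite mem_enum => /(_ isT)/asboolP.
  by apply/allP => i _; apply/asboolP.
have wrE : word_representable G <-> forall i, word_representable (H i).
  split=> [/word_representableP[k /repE rep] i | wrH].
    by apply/word_representableP; exists k.
  have /choice[k repk] i : exists k, k_representable (H i) k.
    exact/word_representableP.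
  (* The components may come with different multiplicities; monotonicity lifts all of them to the
     maximum. *)
  apply/word_representableP; exists (\max_i k i); apply/repE => i.
  exact: k_representable_leq (leq_bigmax i) (repk i).
split=> // wrG; have wrH := wrE.1 wrG.
(* Two numbers with the same upper bounds are equal, and both bounds by [k] amount to
   [k]-representability. *)
have leqE k : (representation_number G <= k)
    = (\max_(i < s) representation_number (H i) <= k).
  apply/idP/bigmax_leqP => [/(representation_number_leq k wrG)/repE rep i _ | le_k].
    exact/representation_number_leq.
  apply/representation_number_leq/repE => // i.
  exact/representation_number_leq/le_k.
by apply/eqP; rewrite eqn_leq leqE leqnn -leqE leqnn.
Qed.
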